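(* Let $Z=\mathbb R^N\times\mathbb R^N$, $\mu\in\mathcal M(Z\times Z)$ and $\beta>0$ be such that $\mu_\beta\in\mathcal M_b(Z\times Z)$. Then: (i) $G_\beta$ is weakly lower-semicontinuous in $\mathcal M_b(Z\times Z)$. (ii) $G_\beta$ is weakly coercive in $\mathcal M_b(Z\times Z)$. (iii) The thermalized measure $\mu_\beta$ is the unique minimizer of $G_\beta$ (over $\mathcal M_b(Z\times Z)$).
   Context: $N\ge1$ is an integer; $Z=\mathbb R^N\times\mathbb R^N$ is endowed with a scalar product, with corresponding norm $\|\cdot\|$. For a metric space $X$, $\mathcal M(X)$ is the set of (positive) Radon measures on $X$, $\mathcal M_b(X)=\{\mu\in\mathcal M(X):\mu(X)<\infty\}$, and $|\mu|:=\mu(X)$. Weak convergence $\nu_j\rightharpoonup\nu$ in $\mathcal M_b(X)$ means $\int f\,d\nu_j\to\int f\,d\nu$ for all bounded continuous $f:X\to\mathbb R$. A functional on $\mathcal M_b(X)$ is weakly coercive if each of its sublevel sets $\{\nu: G(\nu)\le t\}$, $t\in\mathbb R$, is relatively compact for weak convergence. For $\mu\in\mathcal M(Z\times Z)$ and $\beta>0$, the thermalized measure is $$\mu_\beta:=w_\beta\,\mu,\quad w_\beta(y,z):=B_\beta^{-1}e^{-\beta\|y-z\|^2},\quad B_\beta:=\int_Z e^{-\beta\|\xi\|^2}\,d\xi .$$ When $\mu_\beta\in\mathcal M_b(Z\times Z)$, the functional $G_\beta:\mathcal M_b(Z\times Z)\to(-\infty,+\infty]$ is the Kullback–Leibler divergence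 with respect to $\mu_\beta$: $$G_\beta(\nu):=\int_{Z\times Z}\log\Big(\frac{d\nu}{d\mu_\beta}\Big)\,d\nu-|\nu|+|\mu_\beta|$$ if $\nu\ll\mu_\beta$ and $\log(d\nu/d\mu_\beta)\in L^1(Z\times Z,\nu)$, and $G_\beta(\nu):=+\infty$ otherwise. *)

(* Defs.v *)
From HB Require Import structures.
From mathcomp Require Import all_boot all_order all_algebra.
From mathcomp Require Import sesquilinear.
From mathcomp Require Import all_classical all_reals all_analysis.
From mathcomp Require Import measurable_realfun giry.

Set Implicit Arguments.
Unset Strict Implicit.
Unset Printing Implicit Defensive.

Import Order.TTheory GRing.Theory Num.Theory.
Import numFieldNormedType.Exports.

Local Open Scope classical_set_scope.
Local Open Scope ring_scope.

HB.instance Definition _ (T U : ptopologicalType) := Pointed.on (T * U)%type.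

(* The topological space X, measured by its Borel sigma-algebra. *)
Notation borel X := (g_sigma_algebraType (@open X)).

Section borel_theory.
Context {R : realType} {X : ptopologicalType}.

Lemma continuous_measurable_borel (f : X -> R) :
  continuous f -> measurable_fun [set: borel X] f.
Proof.
move=> /continuousP cf.
apply: (measurability _ (RGenOpens.measurableE R)) => _ [_ [a [b ->] <-]].
by rewrite setTI; apply: sub_sigma_algebra; exact/cf/interval_open.
Qed.

End borel_theory.

(* Positive Radon measures: Borel measures that are finite on compact sets. *)
Definition radon {R : realType} {X : ptopologicalType}
    (mu : {measure set (borel X) -> \bar R}) : Prop :=
  forall K : set X, compact K -> (mu K < +oo)%E.

Section finite_measures.
Context {R : realType} {X : ptopologicalType}.

(* M_b(X); a finite Borel measure is Radon by monotonicity. *)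
Definition Mb : Type := {finite_measure set (borel X) -> \bar R}.

HB.instance Definition _ := gen_eqMixin Mb.
HB.instance Definition _ := gen_choiceMixin Mb.

Definition Cb : Type := {f : X -> R | continuous f /\ bounded_fun f}.

Definition pairing (nu : Mb) : {ptws Cb -> R} :=
  fun f => \int[nu]_(x in setT) sval f x.

(* The topology of weak convergence: the coarsest one for which every
   nu |-> \int f dnu, with f bounded and continuous, is continuous.
   A measure is a function on all sets, including non-measurable ones, so this
   topology separates measures only up to measure_eq. *)
HB.instance Definition _ := Topological.copy Mb (initial_topology pairing).

Let cvg_initialE (S : choiceType) (T : topologicalType) (f : S -> T)
    (F : set_system S) (s : S) : Filter F ->
  (F --> (s : initial_topology f)) <-> (f @ F --> f s).
Proof.
move=> FF; split => [Fs A /initial_continuous|Fs A]; first exact: Fs.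
rewrite nbhsE => -[_ [[B oB <-] Bs]] /filterS; apply.
by apply: Fs; exact: open_nbhs_nbhs.
Qed.

Lemma weak_cvgP (F : set_system Mb) (nu : Mb) : Filter F ->
  (F --> nu) <->
  forall f : X -> R, continuous f -> bounded_fun f ->
    (fun m : Mb => \int[m]_(x in setT) f x) @ F --> \int[nu]_(x in setT) f x.
Proof.
move=> FF; rewrite cvg_initialE; split => [Fnu f cf bf|Fnu].
  have /cvg_sup/(_ (exist _ f (conj cf bf))) := Fnu.
  by move/cvg_initialE.
apply/cvg_sup => -[f [cf bf]]; apply/cvg_initialE; exact: Fnu.
Qed.

End finite_measures.
Arguments Mb R X : clear implicits.
Arguments Cb R X : clear implicits.

Section relative_entropy.
Context {R : realType} {X : ptopologicalType}.
Local Open Scope ereal_scope.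
Local Open Scope charge_scope.

Definition log_density (m nu : Mb R X) (x : borel X) : \bar R :=
  lne (('d (charge_of_finite_measure nu) '/d m) x).

Definition KL (m nu : Mb R X) : \bar R :=
  if `[< nu `<< m /\ nu.-integrable setT (log_density m nu) >]
  then \int[nu]_x log_density m nu x - nu setT + m setT
  else +oo.

End relative_entropy.

Definition weakly_coercive {R : realType} {X : ptopologicalType}
    (G : Mb R X -> \bar R) : Prop :=
  forall t : R, precompact [set nu | (G nu <= t%:E)%E].

(* Measures are compared on measurable sets only. *)
Definition unique_minimizer {R : realType} {X : ptopologicalType}
    (G : Mb R X -> \bar R) (m : Mb R X) : Prop :=
  (forall nu, (G m <= G nu)%E) /\
  (forall nu, (forall nu', (G nu <= G nu')%E) -> measure_eq nu m).

Section lebesgue_tuple.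
Context {R : realType}.
Notation RT := (measurableTypeR R).

Definition tcons n (p : RT * n.-tuple RT) : n.+1.-tuple RT :=
  [the n.+1.-tuple RT of p.1 :: p.2].

Section step.
Context (n : nat) (m : {sigma_finite_measure set (n.-tuple RT) -> \bar R}).

Let measurable_tcons : measurable_fun setT (@tcons n).
Proof. exact: measurable_cons. Qed.

Definition lebesgue_step := pushforward (@lebesgue_measure R \x m)%E (@tcons n).

Let step0 : lebesgue_step set0 = 0%E.
Proof. by rewrite /lebesgue_step /pushforward preimage_set0 measure0. Qed.

Let step_ge0 A : (0 <= lebesgue_step A)%E.
Proof. exact: measure_ge0. Qed.

Let step_sigma_additive : semi_sigma_additive lebesgue_step.
Proof.
rewrite /lebesgue_step.
exact: (@measure_semi_sigma_additive _ _ _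
  (measure_function_pushforward__canonical__measure_function_Measure
     (@lebesgue_measure R \x m)%E measurable_tcons)).
Qed.

HB.instance Definition _ := isMeasure.Build _ _ _ lebesgue_step
  step0 step_ge0 step_sigma_additive.

Let step_sigma_finite : sigma_finite setT lebesgue_step.
Proof.
have /sigma_finiteP[F [FT ndF mF]] := sigma_finiteT (@lebesgue_measure R).
have /sigma_finiteP[G [GT ndG mG]] := sigma_finiteT m.
pose u (t : n.+1.-tuple RT) : RT * n.-tuple RT := (thead t, [tuple of behead t]).
have mu : measurable_fun setT u.
  apply/measurable_fun_pair; first exact: measurable_tnth.
  exact: measurable_behead.
have uK : cancel (@tcons n) u.
  by move=> [x t]; congr pair; apply: val_inj.
exists (fun k => u @^-1` (F k `*` G k)).
  rewrite -preimage_bigcup (_ : \bigcup_k _ = setT) ?preimage_setT//.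
  apply/seteqP; split => // -[x t] _.
  have [i _ Fix] : (\bigcup_i F i) x by rewrite -FT.
  have [j _ Gjt] : (\bigcup_i G i) t by rewrite -GT.
  exists (maxn i j) => //; split => /=.
    exact/(subsetPset _ _ (ndF _ _ (leq_maxl i j))).
  exact/(subsetPset _ _ (ndG _ _ (leq_maxr i j))).
move=> k; have [mFk Fkoo] := mF k; have [mGk Gkoo] := mG k; split.
  by rewrite -[X in measurable X]setTI; apply: mu => //; exact: measurableX.
rewrite /lebesgue_step /pushforward -comp_preimage.
rewrite (_ : u \o _ = id); last by apply/funext => p; exact: uK.
rewrite preimage_id product_measure1E// lte_mul_pinfty//.
by rewrite ge0_fin_numE.
Qed.

HB.instance Definition _ := Measure_isSigmaFinite.Build _ _ _ lebesgue_step
  step_sigma_finite.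

End step.

Fixpoint lebesgue_tuple n : {sigma_finite_measure set (n.-tuple RT) -> \bar R} :=
  if n is n'.+1 then lebesgue_step (lebesgue_tuple n') else \d_([tuple] : 0.-tuple RT).

Lemma lebesgue_tuple_box n (A : 'I_n -> set RT) :
  (forall i, measurable (A i)) ->
  lebesgue_tuple n [set t | forall i, A i (tnth t i)] =
  (\prod_(i < n) lebesgue_measure (A i))%E.
Proof.
elim: n A => [|n IHn] A mA.
  rewrite big_ord0 /= diracE mem_set//= => -[]//.
rewrite big_ord_recl -IHn//= /lebesgue_step /pushforward.
rewrite -product_measure1E//=.
  congr (_ _); apply/seteqP; split => -[x t] /=.
    move=> H; split => [|i]; first by have := H ord0; rewrite tnth0.
    by have := H (lift ord0 i); rewrite tnthS.
  move=> [Ax At] i; case: (unliftP ord0 i) => [j|] ->; last by rewrite tnth0.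
  by rewrite tnthS.
rewrite (_ : [set _ | _] =
  \bigcap_(i in [set: 'I_n]) ((@tnth n RT)^~ i @^-1` A (lift ord0 i))).
  apply: fin_bigcap_measurable => // i _.
  by rewrite -[X in measurable X]setTI; exact: measurable_tnth.
by apply/seteqP; split => t /= H i; [move=> _; exact: H|exact: H].
Qed.

End lebesgue_tuple.

Notation phase R N := ('rV[R]_N * 'rV[R]_N)%type.

Section thermalization.
Context {R : realType} {N : nat} (ip : {dot phase R N for idfun}).

Definition dotnorm (z : phase R N) : R := Num.sqrt (ip z z).

Lemma dotnorm_continuous : continuous dotnorm.
Proof.
pose e (k : 'I_N + 'I_N) : phase R N := match k with
  | inl i => ('e_i, 0) | inr i => (0, 'e_i) end.
pose c (k : 'I_N + 'I_N) (z : phase R N) : R := match k with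
  | inl i => z.1 0 i | inr i => z.2 0 i end.
have fstS (F : 'I_N + 'I_N -> phase R N) : (\sum_k F k).1 = \sum_k (F k).1.
  by apply: (big_morph (fun z : phase R N => z.1)).
have sndS (F : 'I_N + 'I_N -> phase R N) : (\sum_k F k).2 = \sum_k (F k).2.
  by apply: (big_morph (fun z : phase R N => z.2)).
have zE z : z = \sum_k c k z *: e k.
  rewrite [RHS]surjective_pairing fstS sndS !big_sumType/= [LHS]surjective_pairing.
  congr pair.
    rewrite [X in _ + X]big1 ?addr0 => [|i _]; last by rewrite scaler0.
    exact: row_sum_delta.
  rewrite [X in X + _]big1 ?add0r => [|i _]; last by rewrite scaler0.
  exact: row_sum_delta.
have cc k : continuous (c k).
  case: k => i z.
    apply: (@continuous_comp _ _ _ fst (fun v : 'rV[R]_N => v 0 i)).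
      exact: cvg_fst.
    exact: coord_continuous.
  apply: (@continuous_comp _ _ _ snd (fun v : 'rV[R]_N => v 0 i)).
    exact: cvg_snd.
  exact: coord_continuous.
have ipE z : ip z z = \sum_k \sum_l c k z * (c l z * ip (e k) (e l)).
  rewrite {1}(zE z) linear_sumlz; apply: eq_bigr => k _.
  rewrite linearZl_LR/= {2}(zE z) linear_sumr mulr_sumr.
  by apply: eq_bigr => l _; rewrite linearZr_LR.
move=> z; apply: (@continuous_comp _ _ _ (fun u => ip u u) (@Num.sqrt R)).
  2: exact: sqrt_continuous.
rewrite (_ : (fun u => ip u u) =
    fun u => \sum_k \sum_l c k u * (c l u * ip (e k) (e l))); last exact/funext.
apply: cvg_big => [|k _]; first exact: add_continuous.
apply: cvg_big => [|l _]; first exact: add_continuous.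
apply: cvgM; first exact: cc.
by apply: cvgM; [exact: cc|exact: cvg_cst].
Qed.

(* R^N x R^N is identified with pairs of N-tuples of coordinates. *)
Definition gauss_mass (beta : R) : R :=
  \int[(lebesgue_tuple N \x lebesgue_tuple N)%E]_(t in setT)
    expR (- beta * dotnorm (\row_i tnth t.1 i, \row_i tnth t.2 i) ^+ 2).

Definition gauss_weight (beta : R) (x : phase R N * phase R N) : R :=
  (gauss_mass beta)^-1 * expR (- beta * dotnorm (x.1 - x.2) ^+ 2).

Lemma gauss_weight_ge0 beta x : 0 <= gauss_weight beta x.
Proof.
rewrite mulr_ge0 ?expR_ge0// invr_ge0 fine_ge0//.
by apply: integral_ge0 => t _; rewrite lee_fin expR_ge0.
Qed.

Lemma gauss_weight_continuous beta : continuous (gauss_weight beta).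
Proof.
move=> x; apply: cvgM; first exact: cvg_cst.
apply: continuous_comp; last exact: continuous_expR.
apply: cvgM; first exact: cvg_cst.
rewrite /=; under eq_fun do rewrite expr2.
have h : (fun y : phase R N * phase R N => dotnorm (y.1 - y.2)) @ x
    --> dotnorm (x.1 - x.2).
  apply: (@continuous_comp _ _ _ (fun y : phase R N * phase R N => y.1 - y.2)).
    by apply: cvgB; [exact: cvg_fst|exact: cvg_snd].
  exact: dotnorm_continuous.
by rewrite expr2; exact: cvgM.
Qed.

Section thermalized_measure.
Context (mu : {measure set (borel (phase R N * phase R N)%type) -> \bar R}).
Context (beta : R).

Definition thermalized (A : set (borel (phase R N * phase R N)%type)) : \bar R :=
  (\int[mu]_(x in A) (gauss_weight beta x)%:E)%E.

Let thermalized0 : thermalized set0 = 0%E.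
Proof. exact: integral_set0. Qed.

Let thermalized_ge0 A : (0 <= thermalized A)%E.
Proof. by apply: integral_ge0 => x _; rewrite lee_fin gauss_weight_ge0. Qed.

Let thermalized_sigma_additive : semi_sigma_additive thermalized.
Proof.
move=> F mF tF mUF; rewrite /thermalized ge0_integral_bigcup//.
- apply: is_cvg_ereal_nneg_natsum_cond => n _ _; exact: thermalized_ge0.
- apply: measurable_funTS; apply/measurable_EFinP.
  apply: (@continuous_measurable_borel R (phase R N * phase R N)%type).
  exact: gauss_weight_continuous.
- by move=> x _; rewrite lee_fin gauss_weight_ge0.
Qed.

HB.instance Definition _ := isMeasure.Build _ _ _ thermalized
  thermalized0 thermalized_ge0 thermalized_sigma_additive.

Section finite.
Hypothesis fin : (thermalized setT < +oo)%E.

Definition thermalized_fin := thermalized.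

HB.instance Definition _ := Measure.on thermalized_fin.

Let thermalized_finite : fin_num_fun thermalized_fin.
Proof.
apply: lty_fin_num_fun; exact: fin.
Qed.

HB.instance Definition _ :=
  Measure_isFinite.Build _ _ _ thermalized_fin thermalized_finite.

Definition thermalized_Mb : Mb R (phase R N * phase R N)%type := thermalized_fin.

End finite.

End thermalized_measure.
End thermalization.

(* Main.v *)
Require Import Defs.
From HB Require Import structures.
From mathcomp Require Import all_boot all_order all_algebra.
From mathcomp Require Import sesquilinear.
From mathcomp Require Import all_classical all_reals all_analysis.
From mathcomp Require Import measurable_realfun lra.

Set Implicit Arguments.
Unset Strict Implicit.
Unset Printing Implicit Defensive.

Import Order.TTheory GRing.Theory Num.Theory.
Import numFieldNormedType.Exports.

Local Open Scope classical_set_scope.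
Local Open Scope ring_scope.

(* For a finite Borel measure [m], the entropy is the Legendre-type supremum
   [KL m nu = sup_f (\int f dnu - \int (exp f - 1) dm)], over bounded measurable
   [f], or equivalently over bounded continuous [f], since these are dense in
   L1 of a finite Borel measure on a metric space. The second form exhibits [KL]
   as a supremum of weakly continuous functionals, whence semicontinuity.
   With [f = c * \1_A] the formula gives
   [c * nu A <= KL m nu + (exp c - 1) * m A]. So a sublevel set is bounded and
   uniformly absolutely continuous with respect to [m]: along an ultrafilter its
   members converge on every Borel set, and the limit is countably additive.
   This replaces Prokhorov's theorem. The same inequality forces [nu = m] when
   [KL m nu = 0]. *)

(** * Bounded measurable functions and their integrals against finite measures *)

Section bounded_measurable.
Context d (T : measurableType d) (R : realType).
Implicit Types f g : T -> R.

Definition bounded_measurable f :=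
  measurable_fun [set: T] f /\ exists C, forall x, `|f x| <= C.

Lemma bounded_measurable_cst r : bounded_measurable (cst r).
Proof. by split; [exact: measurable_cst|exists `|r|]. Qed.

Lemma bounded_measurable_indic A : measurable A -> bounded_measurable \1_A.
Proof.
move=> mA; split; first exact: measurable_indic.
by exists 1 => x; rewrite indicE ger0_norm// lern1 leq_b1.
Qed.

Lemma bounded_measurableD f g : bounded_measurable f -> bounded_measurable g ->
  bounded_measurable (fun x => f x + g x).
Proof.
move=> [mf [C fC]] [mg [D gD]]; split; first exact: measurable_funD.
by exists (C + D) => x; rewrite (le_trans (ler_normD _ _))// lerD.
Qed.

Lemma bounded_measurableZ r f : bounded_measurable f ->
  bounded_measurable (fun x => r * f x).
Proof.
move=> [mf [C fC]]; split; first exact: measurable_funM.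
by exists (`|r| * C) => x; rewrite normrM ler_wpM2l.
Qed.

Lemma bounded_measurableB f g : bounded_measurable f -> bounded_measurable g ->
  bounded_measurable (fun x => f x - g x).
Proof.
move=> mf /(bounded_measurableZ (-1)) /(bounded_measurableD mf).
by under [X in bounded_measurable X -> _]eq_fun do rewrite mulN1r.
Qed.

Lemma bounded_measurable_norm f : bounded_measurable f ->
  bounded_measurable (fun x => `|f x|).
Proof.
move=> [mf [C fC]]; split; first exact: measurableT_comp.
by exists C => x; rewrite normr_id.
Qed.

Lemma bounded_measurable_expR f : bounded_measurable f ->
  bounded_measurable (fun x => expR (f x)).
Proof.
move=> [mf [C fC]]; split; first exact: measurableT_comp.
exists (expR C) => x; rewrite ger0_norm ?expR_ge0// ler_expR.
exact: le_trans (ler_norm _) (fC x).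
Qed.

(* For [f >= 0] the approximant is
   [\sum_(1 <= k <= n) e * \1_[set x | k * e <= f x]], which rounds [f] down to
   a multiple of [e]. *)
Lemma bounded_measurable_ind (Q : (T -> R) -> Prop) :
  (forall A, measurable A -> Q \1_A) ->
  (forall f g, bounded_measurable f -> bounded_measurable g ->
    Q f -> Q g -> Q (fun x => f x + g x)) ->
  (forall r f, bounded_measurable f -> Q f -> Q (fun x => r * f x)) ->
  (forall f, bounded_measurable f -> (forall e, 0 < e -> exists g,
    [/\ bounded_measurable g, Q g & forall x, `|f x - g x| <= e]) -> Q f) ->
  forall f, bounded_measurable f -> Q f.
Proof.
move=> Q1 QD QZ Qlim.
have Qge0 f : bounded_measurable f -> (forall x, 0 <= f x) -> Q f.
  move=> bf f0; apply: Qlim => // e e0.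
  have [mf [C fC]] := bf.
  (* Invariant of the [n]-th partial sum: it equals [n * e] where [f] reaches that height, and lies
     below [f] by at most [e] elsewhere. Once [n * e > C], only the second case occurs. *)
  have step n : exists g, [/\ bounded_measurable g, Q g & forall x,
      (n%:R * e <= f x -> g x = n%:R * e) /\
      (f x < n%:R * e -> g x <= f x <= g x + e)].
    elim: n => [|n [g [bg Qg gf]]].
      exists (fun x => 0 * \1_setT x); split.
      - exact/bounded_measurableZ/bounded_measurable_indic.
      - by apply: QZ; [exact: bounded_measurable_indic|exact: Q1].
      - move=> x; rewrite !mul0r; split => // /lt_le_trans /(_ (f0 x)).
        by rewrite ltxx.
    pose A := [set x | n.+1%:R * e <= f x].
    have mA : measurable A.
      rewrite (_ : A = f @^-1` `[n.+1%:R * e, +oo[%classic); last first.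
        by apply/seteqP; split => x /=; rewrite in_itv/= andbT.
      by rewrite -[X in measurable X]setTI; exact: mf.
    have b1 := bounded_measurable_indic mA.
    exists (fun x => g x + e * \1_A x); split.
    - by apply: bounded_measurableD => //; exact: bounded_measurableZ.
    - by apply: QD => //; [exact: bounded_measurableZ|exact/QZ/Q1].
    move=> x; rewrite indicE.
    have [g1 g2] := gf x; have -> : n.+1%:R * e = n%:R * e + e.
      by rewrite -natr1 mulrDl mul1r.
    split => [fx|fx].
      rewrite mem_set /A/= ?g1 ?mulr1//.
        by rewrite (le_trans _ fx)// lerDl ltW.
      by rewrite -natr1 mulrDl mul1r.
    rewrite memNset /A/= ?mulr0 ?addr0; last first.
      by apply/negP; rewrite -ltNge -natr1 mulrDl mul1r.
    by have [nf|/g2//] := leP (n%:R * e) (f x); rewrite g1// nf/= ltW.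
  have [n Cn] : exists n, C < n%:R * e.
    exists (Num.truncn (C / e)).+1; rewrite -ltr_pdivrMr//.
    exact: truncnS_gt.
  have [g [bg Qg gf]] := step n; exists g; split => // x.
  have /andP[gx fx] : g x <= f x <= g x + e.
    by apply: (gf x).2; rewrite (le_lt_trans _ Cn)// (le_trans (ler_norm _)).
  by rewrite ler_norml; apply/andP; split; lra.
move=> f bf; have [mf [C fC]] := bf.
have Q0 : Q (fun x => f x + C).
  apply: Qge0.
    by apply: bounded_measurableD => //; exact: bounded_measurable_cst.
  by move=> x; have := fC x; rewrite ler_norml => /andP[? _]; lra.
have QC : Q (fun x => - C * \1_setT x).
  by apply: QZ; [exact: bounded_measurable_indic|exact: Q1].
rewrite (_ : f = fun x => (f x + C) + - C * \1_setT x); last first.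
  by apply/funext => x; rewrite indicE in_setT mulr1 addrK.
apply: QD => //; first exact/bounded_measurableD/bounded_measurable_cst.
exact/bounded_measurableZ/bounded_measurable_indic.
Qed.

Section Rintegral.
Variable mu : {measure set T -> \bar R}.
Hypothesis muoo : (mu setT < +oo)%E.

Lemma bounded_measurable_integrable f : bounded_measurable f ->
  mu.-integrable setT (EFin \o f).
Proof.
move=> [mf [C fC]]; apply: measurable_bounded_integrable => //.
exists C; split; [exact: num_real|move=> M CM x _].
exact: le_trans (fC x) (ltW CM).
Qed.

Lemma Rintegral_indic A : measurable A ->
  \int[mu]_(x in setT) \1_A x = fine (mu A).
Proof. by move=> mA; rewrite /Rintegral integral_indic// setIT. Qed.

Lemma Rintegral_dist_le f g e : bounded_measurable f -> bounded_measurable g ->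
  (forall x, `|f x - g x| <= e) ->
  `|\int[mu]_(x in setT) f x - \int[mu]_(x in setT) g x| <= e * fine (mu setT).
Proof.
move=> bf bg fge; have bfg := bounded_measurableB bf bg.
rewrite -RintegralB//; [|exact: bounded_measurable_integrable..].
apply: (le_trans (le_normr_Rintegral _ (bounded_measurable_integrable bfg))) => //.
rewrite -Rintegral_cst//; apply: le_Rintegral => //.
- exact/bounded_measurable_integrable/bounded_measurable_norm.
- exact/bounded_measurable_integrable/bounded_measurable_cst.
Qed.

End Rintegral.
End bounded_measurable.

(** * Density of bounded continuous functions in L1 of a finite Borel measure *)

Section L1_density.
Context {R : realType} {X : ptopologicalType}.
Variable P : {measure set (borel X) -> \bar R}.
Hypothesis Poo : (P setT < +oo)%E.
Implicit Types f g : borel X -> R.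

Let L1dist f g := \int[P]_(x in setT) `|f x - g x|.

Let bounded_measurable_dist f g :
  bounded_measurable f -> bounded_measurable g ->
  bounded_measurable (fun x => `|f x - g x|).
Proof. by move=> bf bg; exact/bounded_measurable_norm/bounded_measurableB. Qed.

Let L1dist_triangle g f h : bounded_measurable f -> bounded_measurable g ->
  bounded_measurable h -> L1dist f h <= L1dist f g + L1dist g h.
Proof.
move=> bf bg bh; rewrite /L1dist.
have i u v : bounded_measurable u -> bounded_measurable v ->
    P.-integrable setT (EFin \o (fun x => `|u x - v x|)).
  by move=> bu bv; exact/bounded_measurable_integrable/bounded_measurable_dist.
rewrite -RintegralD//; [|exact: i..]; apply: le_Rintegral => //; first exact: i.
  apply: bounded_measurable_integrable => //.
  by apply: bounded_measurableD; exact: bounded_measurable_dist.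
by move=> x _; rewrite (le_trans _ (ler_normD _ _))// addrA subrK.
Qed.

Let bounded_continuous g :=
  continuous (g : X -> R) /\ exists C, forall x, `|g x| <= C.

Let bounded_continuous_measurable g :
  bounded_continuous g -> bounded_measurable g.
Proof. by move=> [cg bg]; split => //; exact: continuous_measurable_borel. Qed.

Let L1approx f :=
  forall e, 0 < e -> exists2 g, bounded_continuous g & L1dist f g < e.

Let L1approx_closed f : bounded_measurable f ->
  (forall e, 0 < e -> exists g,
    [/\ bounded_measurable g, L1approx g & L1dist f g < e]) -> L1approx f.
Proof.
move=> bf cl e e0; have e20 : 0 < e / 2 by rewrite divr_gt0.
have [g [bg /(_ _ e20)[h ch gh] fg]] := cl _ e20.
exists h => //; rewrite (splitr e) (le_lt_trans (L1dist_triangle bf bg _))//.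
  exact: bounded_continuous_measurable.
exact: ltrD.
Qed.

Let L1approx_dominated (f_ : (borel X -> R)^nat) f C : bounded_measurable f ->
  (forall n, bounded_measurable (f_ n)) -> (forall n x, `|f_ n x| <= C) ->
  (forall n, L1approx (f_ n)) ->
  (forall x, f_ n x @[n --> \oo] --> f x) -> L1approx f.
Proof.
move=> bf bf_ f_C af_ f_f; apply: L1approx_closed => // e e0.
have [] := @dominated_convergence _ _ _ P setT measurableT
  (fun n => EFin \o f_ n) (EFin \o f) (EFin \o cst C).
- by move=> n; apply/measurable_EFinP; exact: (bf_ n).1.
- by apply/measurable_EFinP; exact: bf.1.
- by apply: aeW => x _; apply: cvg_EFin; [exact: nearW|exact: f_f].
- exact/bounded_measurable_integrable/bounded_measurable_cst.
- by apply: aeW => x n _; rewrite lee_fin.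
move=> _ + _ => /fine_cvgP[_] /cvgrPdist_lt /(_ _ e0) [n _ /(_ n (leqnn n))].
rewrite sub0r normrN ger0_norm; last first.
  by rewrite fine_ge0//; apply: integral_ge0 => x _; exact: abse_ge0.
move=> fe; exists (f_ n); split => //; rewrite (le_lt_trans _ fe)//.
rewrite /L1dist /Rintegral/= le_eqVlt; apply/orP; left; apply/eqP.
by congr fine; apply: eq_integral => x _ /=; rewrite distrC.
Qed.

Let L1approxD f g : bounded_measurable f -> bounded_measurable g ->
  L1approx f -> L1approx g -> L1approx (fun x => f x + g x).
Proof.
move=> bf bg af ag e e0; have e20 : 0 < e / 2 by rewrite divr_gt0.
have [f' [cf' [C f'C]] ff'] := af _ e20.
have [g' [cg' [D g'D]] gg'] := ag _ e20.
exists (fun x => f' x + g' x).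
  split; first by move=> x; apply: cvgD; [exact: cf'|exact: cg'].
  by exists (C + D) => x; rewrite (le_trans (ler_normD _ _))// lerD.
have bf' : bounded_measurable f'.
  by apply: bounded_continuous_measurable; split => //; exists C.
have bg' : bounded_measurable g'.
  by apply: bounded_continuous_measurable; split => //; exists D.
rewrite (splitr e) (le_lt_trans _ (ltrD ff' gg'))//.
rewrite /L1dist -RintegralD//;
  [|exact/bounded_measurable_integrable/bounded_measurable_dist..].
apply: le_Rintegral => //.
- apply: bounded_measurable_integrable => //.
  by apply: bounded_measurable_dist; exact: bounded_measurableD.
- apply: bounded_measurable_integrable => //.
  by apply: bounded_measurableD; exact: bounded_measurable_dist.
- by move=> x _; rewrite opprD addrACA ler_normD.
Qed.

Let L1approxZ r f : bounded_measurable f ->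
  L1approx f -> L1approx (fun x => r * f x).
Proof.
move=> bf af e e0; have r0 : 0 < `|r| + 1 by rewrite ltr_wpDl.
have [|g [cg [C gC]] fg] := af (e / (`|r| + 1)); first by rewrite divr_gt0.
have bg : bounded_measurable g.
  by apply: bounded_continuous_measurable; split => //; exists C.
exists (fun x => r * g x).
  split; first by move=> x; apply: cvgM; [exact: cvg_cst|exact: cg].
  by exists (`|r| * C) => x; rewrite normrM ler_wpM2l.
move: fg; rewrite ltr_pdivlMr// mulrC; apply: le_lt_trans.
rewrite /L1dist (@eq_Rintegral _ _ _ _ _ (fun x => `|r| * `|f x - g x|));
  last by move=> x _; rewrite -mulrBr normrM.
rewrite RintegralZl//; last first.
  exact/bounded_measurable_integrable/bounded_measurable_dist.
by rewrite ler_wpM2r ?lerDl// Rintegral_ge0.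
Qed.

Hypothesis open_cozero : forall U : set X, open U ->
  exists2 g : X -> R, continuous g & U = [set x | 0 < g x].

Let borel_open (U : set X) : open U -> measurable (U : set (borel X)).
Proof. exact: sub_sigma_algebra. Qed.

(** The continuous functions [min 1 (n * max 0 g)] tend pointwise to [\1_U]: they vanish off [U] and
    equal 1 at [x] in [U] once [n >= 1 / g x]. *)
Let L1approx_open (U : set X) : open U -> L1approx \1_U.
Proof.
move=> oU; have [g cg UE] := open_cozero oU.
pose g_ n (x : borel X) := Num.min 1 (n%:R * Num.max 0 (g x)) : R.
have cg_ n : bounded_continuous (g_ n).
  split.
    move=> x; apply: (@continuous_min R X (cst 1)
      (fun y => n%:R * Num.max 0 (g y)) x); first exact: cvg_cst.
    apply: cvgM; first exact: cvg_cst.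
    by apply: (@continuous_max R X (cst 0) g x); [exact: cvg_cst|exact: cg].
  exists 1 => x; rewrite ger0_norm ?ge_min ?lexx//.
  by rewrite le_min ler01 mulr_ge0// le_max lexx.
apply: (@L1approx_dominated g_ _ 1).
- by apply: bounded_measurable_indic; exact: borel_open.
- by move=> n; exact: bounded_continuous_measurable.
- move=> n x; rewrite ger0_norm ?ge_min ?lexx//.
  by rewrite le_min ler01 mulr_ge0// le_max lexx.
- move=> n e e0; exists (g_ n) => //; rewrite /L1dist.
  rewrite (@eq_Rintegral _ _ _ _ _ (cst 0)).
    by rewrite Rintegral_cst// mul0r.
  by move=> x _; rewrite subrr normr0.
- move=> x; rewrite indicE; have [Ux|Ux] := boolP (x \in U).
    have gx : 0 < g x by move: Ux; rewrite inE UE.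
    apply: cvg_near_cst; exists (Num.truncn (g x)^-1).+1 => // n /= gn.
    rewrite /g_ min_l// max_r ?(ltW gx)// -ler_pdivrMr// div1r.
    by rewrite (le_trans (ltW (truncnS_gt _)))// ler_nat.
  have gx : g x <= 0.
    by rewrite leNgt; apply/negP => g0; move: Ux; rewrite notin_setE UE.
  apply: cvg_near_cst; apply: nearW => n.
  by rewrite /g_ max_l// mulr0 min_r.
Qed.

(** Dynkin's pi-lambda argument from the open sets: complements enter through [1 - \1_B], disjoint
    unions as dominated limits of finite sums of indicators. *)
Let L1approx_indic (A : set (borel X)) : measurable A -> L1approx \1_A.
Proof.
move=> mA; pose Q (B : set (borel X)) := measurable B /\ L1approx \1_B.
suff [] : Q A by [].
apply: (@dynkin_induction _ (borel X) (@open X) Q) => //.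
- exact: openI.
- by split => //; apply: L1approx_open; exact: openT.
- by move=> U oU; split; [exact: borel_open|exact: L1approx_open].
- move=> B mB [_ aB]; split; first exact: measurableC.
  rewrite (_ : \1_(~` B) = fun x => \1_setT x + -1 * \1_B x); last first.
    apply/funext => x; rewrite !indicE in_setT in_setC.
    by case: (x \in B) => /=; lra.
  apply: L1approxD; [exact: bounded_measurable_indic|
    exact/bounded_measurableZ/bounded_measurable_indic| |].
  - by apply: L1approx_open; exact: openT.
  - by apply: L1approxZ => //; exact: bounded_measurable_indic.
- move=> F mF tF QF; split; first exact: bigcup_measurable.
  pose G n : set (borel X) := \big[setU/set0]_(i < n) F i.
  have mG n : measurable (G n) by exact: bigsetU_measurable.
  apply: (@L1approx_dominated (fun n => \1_(G n)) _ 1).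
  + by apply: bounded_measurable_indic; exact: bigcup_measurable.
  + by move=> n; exact: bounded_measurable_indic.
  + by move=> n x; rewrite indicE ger0_norm// lern1 leq_b1.
  + elim=> [|n IHn].
      by rewrite /G big_ord0; apply: L1approx_open; exact: open0.
    rewrite (_ : \1_(G n.+1) = fun x => \1_(G n) x + \1_(F n) x).
      apply: L1approxD => //; [exact: bounded_measurable_indic..|].
      by have [] := QF n.
    apply/funext => x; rewrite !indicE /G big_ord_recr/= in_setU -/(G n).
    have [Gx|_] := boolP (x \in G n); last by rewrite add0r.
    rewrite memNset ?addr0// => Fx.
    move: Gx; rewrite inE /G -bigcup_mkord => -[i /= ni Fix].
    have /trivIsetP /(_ i n I I) := tF; rewrite ltn_eqF// => /(_ isT).
    by move=> /seteqP[+ _] => /(_ x); apply; split.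
  + move=> x; rewrite !indicE; have [Fx|Fx] := boolP (x \in \bigcup_k F k).
      move: Fx; rewrite inE => -[k _ Fkx].
      apply: cvg_near_cst; exists k.+1 => // n /= kn.
      by rewrite indicE mem_set// /G -bigcup_mkord; exists k.
    apply: cvg_near_cst; apply: nearW => n.
    rewrite indicE memNset// => Gx; move: Fx; rewrite notin_setE; apply.
    by move: Gx; rewrite /G -bigcup_mkord => -[k _ Fkx]; exists k.
Qed.

(** The approximant keeps the bound [C] of [f], so that exponentials of the two functions can be
    compared with a single Lipschitz constant. *)
Lemma L1_density f C : measurable_fun setT f -> (forall x, `|f x| <= C) ->
  forall e, 0 < e -> exists g : X -> R,
  [/\ continuous g, forall x, `|g x| <= C &
      \int[P]_(x in setT) `|f x - g x| < e].
Proof.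
move=> mf fC e e0; have bf : bounded_measurable f by split => //; exists C.
have C0 : 0 <= C by rewrite (le_trans _ (fC point)).
have : L1approx f.
  apply: (bounded_measurable_ind _ _ _ _ bf) => //.
  move=> h bh apx; apply: L1approx_closed => // r r0.
  (* Adding 1 keeps the divisor positive even for the zero measure. *)
  have M0 : 0 < fine (P setT) + 1 by rewrite ltr_wpDl// fine_ge0.
  have [|g [bg ag hg]] := apx (r / (fine (P setT) + 1)); first exact: divr_gt0.
  exists g; split => //.
  rewrite (@le_lt_trans _ _ (r / (fine (P setT) + 1) * fine (P setT)))//.
    rewrite -Rintegral_cst//; apply: le_Rintegral => //.
      exact/bounded_measurable_integrable/bounded_measurable_dist.
    exact/bounded_measurable_integrable/bounded_measurable_cst.
  by rewrite mulrAC ltr_pdivrMr// ltr_pM2l// ltrDl.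
move=> /(_ _ e0)[g [cg bg] fg].
(* [f] has values in [[-C, C]], so projecting [g] onto this segment does not increase its distance
   to [f]. *)
pose h x := Num.max (- C) (Num.min C (g x)).
have ch : continuous (h : X -> R).
  move=> x; apply: (@continuous_max R X (cst (- C))
    (fun y => Num.min C (g y)) x); first exact: cvg_cst.
  by apply: (@continuous_min R X (cst C) g x); [exact: cvg_cst|exact: cg].
have hC x : `|h x| <= C.
  by rewrite ler_norml le_max lexx/= ge_max ge_min lexx/= andbT ge0_cp.
exists h; split => //; rewrite (le_lt_trans _ fg)// le_Rintegral//.
- apply: bounded_measurable_integrable => //; apply: bounded_measurable_dist => //.
  by apply: bounded_continuous_measurable; split => //; exists C.
- apply: bounded_measurable_integrable => //; apply: bounded_measurable_dist => //.
  by apply: bounded_continuous_measurable.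
- move=> x _; have := fC x; rewrite /h ler_norml => /andP[f1 f2].
  have n1 := ler_norm (f x - g x).
  have n2 : g x - f x <= `|f x - g x| by rewrite distrC ler_norm.
  have [Cg|gC] := leP C (g x).
    by rewrite max_r ?ler_norml; [apply/andP; split; lra|lra].
  have [Cg|gC'] := leP (- C) (g x); first by rewrite lexx.
  by rewrite ler_norml; apply/andP; split; lra.
Qed.

End L1_density.

Lemma Mb_fin {R : realType} {X : ptopologicalType} (n : Mb R X) :
  (n setT < +oo)%E.
Proof. by rewrite ltey_eq fin_num_measure. Qed.

Lemma Mb_integrable {R : realType} {X : ptopologicalType} (n : Mb R X)
  (f : borel X -> R) : bounded_measurable f -> n.-integrable setT (EFin \o f).
Proof. by move=> bf; have := bounded_measurable_integrable (Mb_fin n) bf. Qed.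

(** * The variational formula for the entropy *)

Section variational_formula.
Context {R : realType} {X : ptopologicalType}.
Variables m nu : Mb R X.
Implicit Types f : borel X -> R.

(* The Donsker-Varadhan functional. *)
Definition DV f : R :=
  \int[nu]_(x in setT) f x - \int[m]_(x in setT) (expR (f x) - 1).

(** [expR (c * \1_A) - 1] is [(expR c - 1) * \1_A], since both vanish off [A]. *)
Lemma DV_indic c (A : set (borel X)) : measurable A ->
  DV (fun x => c * \1_A x) = c * fine (nu A) - (expR c - 1) * fine (m A).
Proof.
move=> mA; have b1 := @bounded_measurable_indic _ _ R _ mA.
have i n := Mb_integrable n b1.
rewrite /DV RintegralZl//; last exact: i.
rewrite Rintegral_indic//; congr (_ - _).
rewrite -Rintegral_indic// -RintegralZl//; last exact: i.
apply: eq_Rintegral => x _; rewrite indicE.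
by case: (x \in A) => /=; rewrite ?mulr1// !mulr0 expR0 subrr.
Qed.

Lemma measurable_lne (g : borel X -> R) : measurable_fun setT g ->
  measurable_fun setT (fun x => lne (g x)%:E).
Proof.
move=> mg; rewrite /lne; apply: measurable_fun_ifT => //.
- exact: measurable_fun_ler.
- by apply/measurable_EFinP; exact: measurableT_comp.
Qed.

Section density.
Hypothesis num : nu `<< m.

(** This version of the density is nonnegative and finite at every point, which allows pointwise
    inequalities below. *)
Let h := Radon_Nikodym_SigmaFinite.f nu m.
Let hr x := fine (h x).

Let hE x : h x = (hr x)%:E.
Proof. by rewrite /hr fineK// Radon_Nikodym_SigmaFinite.f_fin_num. Qed.

Let hr_ge0 x : 0 <= hr x.
Proof. by rewrite -lee_fin -hE Radon_Nikodym_SigmaFinite.f_ge0. Qed.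

Let integrable_h : m.-integrable setT h.
Proof. exact: Radon_Nikodym_SigmaFinite.f_integrable. Qed.

Let integrable_hr : m.-integrable setT (EFin \o hr).
Proof. by rewrite (_ : EFin \o hr = h)//; apply/funext => x /=; rewrite -hE. Qed.

Let measurable_hr : measurable_fun setT hr.
Proof. by apply/measurable_EFinP; exact: measurable_int integrable_hr. Qed.

Let measurable_lneh : measurable_fun setT (fun x => lne (h x)).
Proof. by under eq_fun do rewrite hE; exact: measurable_lne. Qed.

Let RN_h : ae_eq m setT h (Radon_Nikodym (charge_of_finite_measure nu) m).
Proof. exact: ae_eq_Radon_Nikodym_SigmaFinite. Qed.

Let change_of_variables (f : borel X -> \bar R) : nu.-integrable setT f ->
  (\int[m]_x (f x * h x) = \int[nu]_x f x)%E.
Proof.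
move=> intf; rewrite -(Radon_Nikodym_change_of_variables num)//.
have mf := measurable_int _ intf.
apply: ae_eq_integral => //.
- by apply: emeasurable_funM => //; exact: measurable_int integrable_h.
- exact: emeasurable_funM.
- exact: ae_eqe_mul2l.
Qed.

(** The two versions of the density agree [m]-almost everywhere, hence [nu]-almost everywhere by
    domination, so integrability and integrals against [nu] are the same for both. *)
Let KL_RN : KL m nu =
  if `[< nu.-integrable setT (fun x => lne (h x)) >]
  then (\int[nu]_x lne (h x) - nu setT + m setT)%E else +oo%E.
Proof.
pose D := Radon_Nikodym (charge_of_finite_measure nu) m.
have Dfin x : D x \is a fin_num by exact: Radon_Nikodym_fin_num.
have mL : measurable_fun setT (log_density m nu).
  rewrite (_ : log_density m nu = fun x => lne (fine (D x))%:E); last first.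
    by apply/funext => x; rewrite fineK.
  apply: measurable_lne; apply/measurable_EFinP.
  rewrite (_ : _ \o _ = D); first exact: measurable_int (Radon_Nikodym_integrable _).
  by apply/funext => x /=; rewrite fineK.
have aeL : ae_eq nu setT (log_density m nu) (fun x => lne (h x)).
  apply: null_dominates_ae_eq num _ => //.
  by apply: filterS RN_h => x hx _; rewrite /log_density -hx.
have -> : (\int[nu]_x lne (h x) = \int[nu]_x log_density m nu x)%E.
  by apply: ae_eq_integral => //; exact: ae_eq_sym.
congr (if _ then _ else _); apply/asbool_equiv_eq; split.
  move=> [_ /integrableP[_ Loo]]; apply/integrableP; split => //.
  rewrite (le_lt_trans _ Loo)// le_eqVlt; apply/orP; left; apply/eqP.
  apply: ae_eq_integral => //; [exact: measurableT_comp..|].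
  by apply: filterS aeL => x Lx _; rewrite Lx.
move=> /integrableP[_ Loo]; split => //; apply/integrableP; split => //.
rewrite (le_lt_trans _ Loo)// le_eqVlt; apply/orP; left; apply/eqP.
apply: ae_eq_integral => //; [exact: measurableT_comp..|].
by apply: filterS aeL => x Lx _; rewrite Lx.
Qed.

(** The convention 0 log 0 = 0: at a zero of the density both products have a zero factor, and
    [\bar R] sends even [-oo * 0] to 0. *)
Let lne_hM x : (lne (h x) * h x = (hr x * ln (hr x))%:E)%E.
Proof.
rewrite hE /lne; have [hx|hx] := leP (hr x) 0; last by rewrite -EFinM mulrC.
have -> : hr x = 0 by apply/eqP; rewrite eq_le hx hr_ge0.
by rewrite mule0 mul0r.
Qed.

(* Young's inequality [1 + s <= expR s] at [s = f - ln h], integrated against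
   [nu = h m]. *)
Lemma KL_ge_dominated f : bounded_measurable f -> ((DV f)%:E <= KL m nu)%E.
Proof.
move=> bf; rewrite KL_RN; case: asboolP => [iL|_]; last by rewrite leey.
have i n g := @Mb_integrable R X n g.
have be := bounded_measurable_expR bf.
pose g x : \bar R := ((f x)%:E - lne (h x) + 1)%E.
have ifL : nu.-integrable setT (fun x => (f x)%:E - lne (h x))%E.
  by apply: integrableB => //; exact: i.
have i1 : nu.-integrable setT (EFin \o cst 1) by exact/i/bounded_measurable_cst.
have ig : nu.-integrable setT g by exact: integrableD.
have key : (\int[nu]_x g x <= (\int[m]_(x in setT) expR (f x))%:E)%E.
  (* A nonnegative integrand can be moved from [nu] to [m] without further integrability, and
     Young's bound survives the positive part because its right-hand side is nonnegative. *)
  apply: (@le_trans _ _ (\int[nu]_x (g^\+ x))%E).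
    apply: le_integral => //; first exact: integrable_funepos.
    by move=> x _; rewrite funeposE le_max lexx.
  rewrite -(Radon_Nikodym_SigmaFinite.change_of_variables num)//; last first.
    exact: measurable_funepos (measurable_int _ ig).
  rewrite /Rintegral fineK; last exact: integrable_fin_num (i m _ be).
  apply: ge0_le_integral => //.
  - by move=> x _; rewrite mule_ge0// Radon_Nikodym_SigmaFinite.f_ge0.
  - apply: emeasurable_funM; last exact: measurable_int integrable_h.
    exact: measurable_funepos (measurable_int _ ig).
  - by apply/measurable_EFinP; exact: be.1.
  - move=> x _; rewrite -/h funeposE /g hE.
    have [h0|h0] := eqVneq (hr x) 0; first by rewrite h0 mule0 lee_fin expR_ge0.
    have hp : 0 < hr x by rewrite lt_neqAle eq_sym h0 hr_ge0.
    rewrite lne_EFin// -EFinB -EFinD -EFin_max -EFinM lee_fin.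
    rewrite -ler_pdivlMr// ge_max divr_ge0 ?expR_ge0// andbT.
    by rewrite -{2}(lnK hp) -expRN -expRD addrC expR_ge1Dx.
move: key; rewrite integralD// integralB//; last exact: i.
rewrite integral_cst// mul1e /DV.
rewrite (RintegralB measurableT (i m _ be) (i m _ (@bounded_measurable_cst _ _ R 1))).
rewrite Rintegral_cst// mul1r /Rintegral.
have fL := integrable_fin_num measurableT iL.
have ff := integrable_fin_num measurableT (i nu _ bf).
have fn : nu setT \is a fin_num by exact: fin_num_measure.
have fm : m setT \is a fin_num by exact: fin_num_measure.
rewrite -(fineK fL) -(fineK fn) -(fineK fm) -(fineK ff).
rewrite -!EFinB -!EFinD !lee_fin.
by rewrite /= -[X in (_ + X <= _)%E]fineK// -EFinD lee_fin; lra.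
Qed.

Let integrableM_hr f : bounded_measurable f ->
  m.-integrable setT (EFin \o (fun x => f x * hr x)).
Proof.
move=> [mf [C fC]]; apply: (integrableMr measurableT mf _ integrable_hr).
exists C; split; [exact: num_real|move=> M CM x _].
exact: le_trans (fC x) (ltW CM).
Qed.

(** Written as one integral against [m], the functional can be maximized pointwise:
    [s * h - (expR s - 1)] is largest at [s = ln h] when [h > 0], with value
    [h * ln h - (h - 1)]. *)
Let DV_RN f : bounded_measurable f ->
  (\int[m]_x (f x * hr x - (expR (f x) - 1))%:E = (DV f)%:E)%E.
Proof.
move=> bf; have bfh := integrableM_hr bf.
have be : bounded_measurable (fun x => expR (f x) - 1).
  apply: bounded_measurableB; first exact: bounded_measurable_expR.
  exact: bounded_measurable_cst.
have ie := Mb_integrable m be.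
have ib : m.-integrable setT (fun x => (f x * hr x - (expR (f x) - 1))%:E).
  by under eq_fun do rewrite EFinB; exact: integrableB.
rewrite -[LHS]fineK; last exact: integrable_fin_num ib.
congr (_%:E); rewrite -/(Rintegral _ _ _) RintegralB//; congr (_ - _).
congr fine; rewrite -change_of_variables; last first.
  by have := Mb_integrable nu bf.
by apply: eq_integral => x _; rewrite hE.
Qed.

(** The optimal [ln h] may be unbounded; the logarithm of [h] clamped to [[1 / (n + 1), n + 1]] is a
    bounded substitute. This interval always contains 1. *)
Let clamp n x := Num.min n.+1%:R (Num.max n.+1%:R^-1 (hr x)).

Let clamp_bounds n x : n.+1%:R^-1 <= clamp n x <= n.+1%:R.
Proof.
rewrite ge_min lexx/= andbT le_min le_max lexx/= andbT.
by rewrite (@le_trans _ _ 1)// ?invf_le1// ler1n.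
Qed.

Let clamp_gt0 n x : 0 < clamp n x.
Proof. by have /andP[+ _] := clamp_bounds n x; apply: lt_le_trans. Qed.

Let bounded_measurable_ln_clamp n :
  bounded_measurable (fun x => ln (clamp n x)).
Proof.
split.
  apply: measurableT_comp => //; apply: measurable_minr => //.
  exact: measurable_maxr.
exists (ln n.+1%:R) => x; have /andP[c1 c2] := clamp_bounds n x.
rewrite ler_norml -lnV ?posrE// !ler_ln ?posrE ?c1 ?c2//.
Qed.

Let phi_clamp n x : ln (clamp n x) * hr x - (expR (ln (clamp n x)) - 1) =
  ln (clamp n x) * hr x - (clamp n x - 1).
Proof. by rewrite lnK ?posrE. Qed.

(** Fatou's lemma needs this sign. Clamping to an interval around 1 moves [h] towards 1, so the
    clamped value [c] satisfies [ln c * (h - c) >= 0]; hence [ln c * h >= c * ln c >= c - 1]. *)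
Let phi_ge0 n x : 0 <= ln (clamp n x) * hr x - (clamp n x - 1).
Proof.
have c0 := clamp_gt0 n x.
have cln : clamp n x - 1 <= clamp n x * ln (clamp n x).
  have := @le_ln1Dx _ ((clamp n x)^-1 - 1).
  rewrite ltrBrDl subrr invr_gt0 => /(_ c0).
  rewrite addrC subrK lnV ?posrE// => l.
  rewrite -ler_pdivrMl// mulrBr mulVf ?gt_eqF// mulr1; lra.
have n1 : (n.+1%:R^-1 <= 1 :> R) by rewrite invf_le1// ler1n.
have n2 : (1 <= n.+1%:R :> R) by rewrite ler1n.
have : clamp n x * ln (clamp n x) <= ln (clamp n x) * hr x; last by lra.
rewrite mulrC; have [c1|c1|->] := ltgtP (clamp n x) 1; last by rewrite ln1 !mul0r.
  rewrite ler_wnM2l ?ln_le0 ?(ltW c1)//.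
  move: c1; rewrite /clamp gt_min ltNge n2/= => h1.
  by rewrite min_r ?le_max ?lexx ?orbT// (le_trans (ltW h1)).
rewrite ler_wpM2l ?ln_ge0 ?(ltW c1)//.
move: c1; rewrite /clamp lt_min lt_max (ltNge 1 n.+1%:R^-1) n1/= => /andP[_ h1].
by rewrite max_r ?ge_min ?lexx ?orbT// (le_trans n1)// ltW.
Qed.

(** Where [h > 0] the clamp is eventually inactive and the sequence constant; where [h = 0] its
    terms are [1 - 1 / (n + 1)]. *)
Let phi_cvg x : ln (clamp n x) * hr x - (clamp n x - 1) @[n --> \oo] -->
  hr x * ln (hr x) - (hr x - 1).
Proof.
have [h0|h0] := eqVneq (hr x) 0.
  rewrite h0 mul0r; under eq_fun => n.
    rewrite mulr0 /clamp h0 max_l// min_r; last first.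
      by rewrite (@le_trans _ _ 1)// ?invf_le1// ler1n.
    over.
  apply: cvgB; first exact: cvg_cst.
  by apply: cvgB; [exact: cvg_harmonic|exact: cvg_cst].
have hp : 0 < hr x by rewrite lt_neqAle eq_sym h0 hr_ge0.
apply: cvg_near_cst; near=> n.
have -> : clamp n x = hr x; last by rewrite mulrC.
rewrite /clamp max_r ?min_r//.
  near: n; exists (Num.truncn (hr x)) => // n /= hn.
  by rewrite (le_trans (ltW (truncnS_gt _)))// ler_nat.
rewrite -[leRHS]invrK lef_pV2 ?posrE ?invr_gt0//.
near: n; exists (Num.truncn (hr x)^-1) => // n /= hn.
by rewrite (le_trans (ltW (truncnS_gt _)))// ler_nat.
Unshelve. all: by end_near. Qed.

(** Fatou's lemma along the clamped logarithms bounds the integral of [phi] by [a]. Its finiteness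
    yields the integrability of the log-density that [KL] requires, and then this integral is
    [KL m nu]. *)
Lemma KL_le_dominated a : (forall f, bounded_measurable f -> DV f <= a) ->
  (KL m nu <= a%:E)%E.
Proof.
move=> DVa; pose phi x := hr x * ln (hr x) - (hr x - 1).
have mhl : measurable_fun setT (fun x => hr x * ln (hr x)).
  by apply: measurable_funM => //; exact: measurableT_comp.
have mphi : measurable_fun setT phi.
  by apply: measurable_funB => //; exact: measurable_funB.
have phi0 x : 0 <= phi x.
  rewrite /phi -(cvg_lim _ (@phi_cvg x))//; apply: limr_ge; last exact: nearW.
  by apply/cvg_ex; eexists; exact: phi_cvg.
have intphi : (\int[m]_x (phi x)%:E <= a%:E)%E.
  pose phi_ n x := (ln (clamp n x) * hr x - (clamp n x - 1))%:E.
  have phi_E n : (\int[m]_x phi_ n x = (DV (fun x => ln (clamp n x)))%:E)%E.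
    rewrite -(DV_RN (bounded_measurable_ln_clamp n)).
    by apply: eq_integral => x _; rewrite phi_clamp.
  have mphi_ n : measurable_fun setT (phi_ n).
    apply/measurable_EFinP; apply: measurable_funB.
      by apply: measurable_funM => //; exact: (bounded_measurable_ln_clamp n).1.
    apply: measurable_funB => //; apply: measurable_minr => //.
    exact: measurable_maxr.
  have phi_phi x : limn_einf (phi_ ^~ x) = (phi x)%:E.
    apply: (cvg_limn_einf_sup _).1; apply: cvg_EFin; first exact: nearW.
    exact: phi_cvg.
  have := @fatou _ _ _ m _ measurableT _ mphi_ (fun n x _ => phi_ge0 n x).
  under eq_integral do rewrite phi_phi.
  move=> /le_trans; apply; rewrite limn_einf_lim.
  apply: lime_le; first exact: is_cvg_einfs.
  apply: nearW => n; rewrite /einfs; apply: ge_ereal_inf.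
  exists (\int[m]_x phi_ n x)%E; first by exists n => /=.
  by rewrite phi_E lee_fin; exact/DVa/bounded_measurable_ln_clamp.
have iphi : m.-integrable setT (EFin \o phi).
  apply/integrableP; split; first exact/measurable_EFinP.
  under eq_integral do rewrite /= ger0_norm//.
  exact: le_lt_trans intphi (ltry _).
have i1 : m.-integrable setT (fun x => (hr x - 1)%:E).
  under eq_fun do rewrite EFinB; apply: (integrableB measurableT integrable_hr).
  by have := Mb_integrable m (@bounded_measurable_cst _ _ R 1).
have ihl : m.-integrable setT (fun x => (hr x * ln (hr x))%:E).
  rewrite (_ : (fun x => _) = ((EFin \o phi) \+ (fun x => (hr x - 1)%:E))%E).
    exact: integrableD.
  by apply/funext => x /=; rewrite -EFinD /phi subrK.
have iL : nu.-integrable setT (fun x => lne (h x)).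
  apply/integrableP; split => //.
  rewrite -(Radon_Nikodym_SigmaFinite.change_of_variables num)//; last first.
    exact: measurableT_comp.
  have /integrableP[_] := ihl; apply: le_lt_trans; apply: ge0_le_integral => //.
  - by move=> x _; rewrite mule_ge0// Radon_Nikodym_SigmaFinite.f_ge0.
  - apply: emeasurable_funM; last exact: measurable_int integrable_h.
    exact: measurableT_comp.
  - by apply/measurable_EFinP; exact: measurableT_comp.
  - by move=> x _; rewrite -/h -lne_hM abseM (@gee0_abs _ (h x))// hE lee_fin.
rewrite KL_RN asboolT// -change_of_variables//.
under eq_integral do rewrite lne_hM.
rewrite (le_trans _ intphi)// le_eqVlt; apply/orP; left; apply/eqP.
rewrite /phi; under [RHS]eq_integral do rewrite EFinB.
rewrite integralB//; under [X in (_ = _ - X)%E]eq_integral do rewrite EFinB.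
rewrite [X in (_ = _ - X)%E]integralB//; last first.
  by have := Mb_integrable m (@bounded_measurable_cst _ _ R 1).
rewrite integral_cst// mul1e.
have -> : (\int[m]_x (hr x)%:E = nu setT)%E.
  rewrite (Radon_Nikodym_SigmaFinite.f_integral num)//.
  by apply: eq_integral => x _; rewrite -hE.
rewrite oppeB ?fin_num_adde_defr ?fin_num_measure// addeA//.
Qed.

End density.
Lemma DV_le_KL f : bounded_measurable f -> ((DV f)%:E <= KL m nu)%E.
Proof.
move=> bf; have [num|num] := pselect (nu `<< m); first exact: KL_ge_dominated.
by rewrite /KL asboolF ?leey// => -[].
Qed.

(** A finite bound forces domination: if [m A = 0 < nu A], the value of [DV] at [c * \1_A] is
    [c * nu A], and the chosen [c] makes it the absolute value of [a] plus 1. *)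
Lemma KL_le a : (forall f, bounded_measurable f -> DV f <= a) ->
  (KL m nu <= a%:E)%E.
Proof.
move=> DVa; apply: KL_le_dominated => //.
apply/null_content_dominatesP => A mA mA0.
rewrite -(fineK (fin_num_measure nu _ mA)); congr (_%:E).
apply/eqP; rewrite eq_le fine_ge0// andbT leNgt; apply/negP => nuA.
have := DVa _ (bounded_measurableZ ((`|a| + 1) / fine (nu A))
  (bounded_measurable_indic R mA)).
rewrite DV_indic// mA0 mulr0 subr0 divfK ?gt_eqF//.
by have := ler_norm a; lra.
Qed.

End variational_formula.

(* As [expR c <= 1 + c + 2 * c ^+ 2] for [`|c| <= 1 / 2], the hypothesis gives
   [c * (a - b) <= 2 * b * c ^+ 2]; it fails at [c = (a - b) / K] if [K > 2 * b]. *)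
Lemma eq_of_entropy_bound {R : realType} (a b : R) : 0 <= b ->
  (forall c, c * a <= (expR c - 1) * b) -> a = b.
Proof.
move=> b0 ab; apply/eqP; rewrite -subr_eq0; apply: contrapT => /negP d0.
(* In [K], the multiple of the norm of [d] keeps [c] within [[-1/2, 1/2]], and [2 * b + 1] ensures
   [K > 2 * b]. *)
set d := a - b in d0; pose K := 2 * `|d| + 2 * b + 1; pose c := d / K.
have nd := normr_ge0 d.
have K0 : 0 < K by rewrite /K; lra.
have dK : d = c * K by rewrite divfK// gt_eqF.
have c2 : `|c| <= 2^-1.
  by rewrite normrM normfV (gtr0_norm K0) ler_pdivrMr// /K; lra.
have [c21 c22] : - 2^-1 <= c /\ c <= 2^-1 by move: c2; rewrite ler_norml => /andP.
(* [expR c <= 1 / (1 - c)], and [(1 - c) * (1 + c + 2 * c ^+ 2) = 1 + c ^+ 2 * (1 - 2 * c)] is at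
   least 1 for [c <= 1 / 2]. *)
have ec : expR c <= 1 + c + 2 * c ^+ 2.
  have e1 : 1 - c <= (expR c)^-1 by rewrite -expRN; exact: expR_ge1Dx.
  have : (1 - c) * expR c <= 1 by rewrite -ler_pdivlMr ?expR_gt0// div1r.
  have := expR_gt0 c; nra.
have := ab c; have -> : a = c * K + b by rewrite -dK /d subrK.
have c0 : 0 < c ^+ 2.
  by rewrite lt_neqAle sqr_ge0 eq_sym sqrf_eq0 mulf_neq0 ?invr_neq0// gt_eqF.
have : (expR c - 1) * b <= (c + 2 * c ^+ 2) * b by rewrite ler_wpM2r//; lra.
have : c ^+ 2 * (2 * b) < c ^+ 2 * K by rewrite ltr_pM2l// /K; lra.
nra.
Qed.

(** * Nonnegativity of the entropy and its unique minimizer *)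

Section unique_minimizer.
Context {R : realType} {X : ptopologicalType}.
Variable m : Mb R X.

Lemma KL_indic (nu : Mb R X) c (A : set (borel X)) : measurable A ->
  ((c * fine (nu A) - (expR c - 1) * fine (m A))%:E <= KL m nu)%E.
Proof.
move=> mA; rewrite -DV_indic//; apply: DV_le_KL.
exact/bounded_measurableZ/bounded_measurable_indic.
Qed.

Lemma KL_ge0 (nu : Mb R X) : (0 <= KL m nu)%E.
Proof.
have := KL_indic nu 0 (@measurableT _ (borel X)).
by rewrite expR0 subrr !mul0r subrr.
Qed.

Lemma KLmm : KL m m = 0%E.
Proof.
apply/eqP; rewrite eq_le KL_ge0 andbT; apply: KL_le => f bf; rewrite subr_le0.
apply: le_Rintegral => //.
- exact (Mb_integrable m bf).
- have be : bounded_measurable (fun x => expR (f x) - 1).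
    apply: bounded_measurableB; first exact: bounded_measurable_expR.
    exact: bounded_measurable_cst.
  exact (Mb_integrable m be).
- by move=> x _; rewrite lerBrDl expR_ge1Dx.
Qed.

(** A minimizer has entropy at most [KL m m = 0], so [KL_indic] gives the hypothesis of
    [eq_of_entropy_bound] on each measurable set. *)
Lemma unique_minimizer_KL : unique_minimizer (KL m) m.
Proof.
split=> [nu|nu numin]; first by rewrite KLmm KL_ge0.
move=> A mA; rewrite -[LHS]fineK ?fin_num_measure// -[RHS]fineK ?fin_num_measure//.
congr (_%:E); apply: eq_of_entropy_bound; first exact: fine_ge0.
move=> c; rewrite -subr_le0 -lee_fin (le_trans (KL_indic nu c mA))//.
by rewrite (le_trans (numin m))// KLmm.
Qed.

End unique_minimizer.

(** Turns an L1 error between exponents into an L1 error between exponentials. *)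
Lemma expR_dist_le {R : realType} (C u v : R) : u <= C -> v <= C ->
  `|expR u - expR v| <= expR C * `|u - v|.
Proof.
wlog uv : u v / v <= u.
  move=> H uC vC; have [/H|/ltW/H] := leP v u; first exact.
  by rewrite distrC (distrC v); apply.
move=> uC vC; rewrite !ger0_norm ?subr_ge0 ?ler_expR//.
have -> : expR v = expR u * expR (v - u) by rewrite -expRD addrC subrK.
rewrite -{1}(mulr1 (expR u)) -mulrBr.
have e1 : 1 - expR (v - u) <= u - v by have := expR_ge1Dx (v - u); lra.
rewrite (le_trans (ler_wpM2l (expR_ge0 u) e1))// ler_wpM2r ?subr_ge0//.
by rewrite ler_expR.
Qed.

(** * Weak lower semicontinuity *)

Section lower_semicontinuity.
Context {R : realType} {X : ptopologicalType}.
Variable m : Mb R X.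
Hypothesis open_cozero : forall U : set X, open U ->
  exists2 g : X -> R, continuous g & U = [set x | 0 < g x].

(** Approximating in L1 of [m + nu] controls both integrals of [DV] at once. *)
Lemma DV_continuous_approx (nu : Mb R X) f a : bounded_measurable f ->
  a < DV m nu f ->
  exists g : X -> R, [/\ continuous g, exists C, forall x, `|g x| <= C &
    a < DV m nu g].
Proof.
move=> bf aDV; have [mf [C fC]] := bf.
pose P : {measure set (borel X) -> \bar R} := measure_add m nu.
have Poo : (P setT < +oo)%E.
  rewrite (_ : P setT = (m setT + nu setT)%E); last exact: measure_addE.
  by rewrite lte_add_pinfty// Mb_fin.
have K0 : 0 < expR C + 1 by rewrite ltr_wpDl// expR_ge0.
have d0 : 0 < DV m nu f - a by rewrite subr_gt0.
(* Replacing [f] by [g] lowers [DV] by at most [expR C + 1] times their L1 distance, hence this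
   tolerance. *)
have [g [cg gC fg]] := L1_density Poo open_cozero mf fC (divr_gt0 d0 K0).
exists g; split => //; first by exists C.
have bg : @bounded_measurable _ (borel X) R g.
  by split; [exact: continuous_measurable_borel|exists C].
have i n h := @Mb_integrable R X n h.
have bd := bounded_measurable_norm (bounded_measurableB bf bg).
have be := bounded_measurable_expR bf; have beg := bounded_measurable_expR bg.
have b1 := @bounded_measurable_cst _ (borel X) R 1.
have PE : \int[P]_(x in setT) `|f x - g x| =
    \int[m]_(x in setT) `|f x - g x| + \int[nu]_(x in setT) `|f x - g x|.
  rewrite /Rintegral ge0_integral_measure_add//; last first.
    by apply/measurable_EFinP; exact: bd.1.
  by rewrite fineD// (integrable_fin_num _ (i _ _ bd)).
have d1 : \int[nu]_(x in setT) f x - \int[nu]_(x in setT) g x <=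
    \int[nu]_(x in setT) `|f x - g x|.
  rewrite -RintegralB//; [|exact: i..].
  apply: le_Rintegral => //; [exact/i/bounded_measurableB|exact: i|].
  by move=> x _; exact: ler_norm.
have d2 : \int[m]_(x in setT) (expR (g x) - 1) -
    \int[m]_(x in setT) (expR (f x) - 1) <=
    expR C * \int[m]_(x in setT) `|f x - g x|.
  rewrite -RintegralB//; [|exact/i/bounded_measurableB..].
  rewrite -RintegralZl//; last exact: i.
  apply: le_Rintegral => //.
  - by apply: i; apply: bounded_measurableB; exact: bounded_measurableB.
  - exact/i/bounded_measurableZ.
  move=> x _; rewrite opprB addrA subrK distrC (le_trans (ler_norm _))//.
  by apply: expR_dist_le; exact: le_trans (ler_norm _) _.
move: fg; rewrite PE ltr_pdivlMr// /DV; move: d1 d2.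
have := @Rintegral_ge0 _ _ R nu setT
  (fun x => `|f x - g x|) (fun x _ => normr_ge0 _).
have := @Rintegral_ge0 _ _ R m setT
  (fun x => `|f x - g x|) (fun x _ => normr_ge0 _).
have := expR_ge0 C.
move: (\int[m]_(x in setT) `|_|) (\int[nu]_(x in setT) `|_|) => u v.
by nra.
Qed.

Lemma lower_semicontinuous_KL : lower_semicontinuous (KL m).
Proof.
move=> nu a aKL.
have [f bf aDV] : exists2 f, bounded_measurable f & a < DV m nu f.
  apply: contrapT => noDV; suff : (KL m nu <= a%:E)%E by rewrite leNgt aKL.
  apply: KL_le => f bf; rewrite leNgt; apply/negP => aDV.
  by apply: noDV; exists f.
have [g [cg [C gC] aDVg]] := DV_continuous_approx bf aDV.
have bg : bounded_fun g.
  exists C; split; [exact: num_real|move=> M CM x _].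
  exact: le_trans (gC x) (ltW CM).
(* For fixed continuous [g], only the first integral of [DV] depends on the measure, and it is
   weakly continuous. *)
exists [set nu' | a < DV m nu' g].
  have gnu := (weak_cvgP nu (nbhs_filter nu)).1 (@cvg_id _ (nbhs nu)) g cg bg.
  have : \forall nu' \near nu, a + \int[m]_(x in setT) (expR (g x) - 1) <
      \int[nu' : Mb R X]_(x in setT) g x.
    apply: (@cvgr_gt R _ (nbhs nu) _
      (fun nu' : Mb R X => \int[nu']_(x in setT) g x) _ gnu).
    by rewrite -ltrBrDr.
  by apply: filterS => nu' /=; rewrite /DV ltrBrDr.
move=> nu' /=; rewrite -lte_fin => /lt_le_trans; apply; apply: DV_le_KL.
by split; [exact: continuous_measurable_borel|exists C].
Qed.

End lower_semicontinuity.

(** * From finite to countable additivity by absolute continuity *)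

Section setwise_limit.
Context d (T : measurableType d) (R : realType).
Variables (m : {finite_measure set T -> \bar R}) (L : set T -> R).
Hypotheses (L0 : L set0 = 0) (L_ge0 : forall A, 0 <= L A).
Hypothesis LU : forall A B, measurable A -> measurable B ->
  A `&` B = set0 -> L (A `|` B) = L A + L B.
Hypothesis L_abs_continuous : forall e, 0 < e -> exists2 r, 0 < r &
  forall A, measurable A -> (m A < r%:E)%E -> L A < e.

Definition additive_measure (A : set T) : \bar R := (L A)%:E.

Let additive_measure0 : additive_measure set0 = 0%E.
Proof. by rewrite /additive_measure L0. Qed.

Let additive_measure_ge0 A : (0 <= additive_measure A)%E.
Proof. by rewrite lee_fin. Qed.

(** The defect of the [n]-th partial sum is [L] of the tail [D n]. Tails decrease to the empty set,
    so their [m]-measure tends to 0, and absolute continuity carries this over to [L]. *)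
Let additive_measure_sigma_additive : semi_sigma_additive additive_measure.
Proof.
move=> F mF tF mUF; pose G n := \big[setU/set0]_(i < n) F i.
have mG n : measurable (G n) by exact: bigsetU_measurable.
have LG n : (\sum_(0 <= i < n) additive_measure (F i))%E = (L (G n))%:E.
  elim: n => [|n IHn]; first by rewrite big_nil /G big_ord0 L0.
  have GF0 : G n `&` F n = set0.
    rewrite -subset0 => x [+ Fx]; rewrite /G -bigcup_mkord => -[i /= ni Fix].
    have /trivIsetP /(_ i n I I) := tF; rewrite ltn_eqF// => /(_ isT).
    by move=> /seteqP[+ _] => /(_ x); apply; split.
  by rewrite big_nat_recr//= IHn /G big_ord_recr/= LU//; exact: mG.
under eq_fun do rewrite LG.
apply: cvg_EFin; first exact: nearW.
pose D n := \bigcup_k F k `\` G n.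
have mD n : measurable (D n) by exact: measurableD.
have LD n : L (\bigcup_k F k) - L (G n) = L (D n).
  have UE : \bigcup_k F k = G n `|` D n.
    by rewrite setDUK// /G -bigcup_mkord => x [i _ Fix]; exists i.
  by rewrite {1}UE LU ?setDIK// addrC addKr.
have mD0 : m (D n) @[n --> \oo] --> 0%E.
  have D0 : \bigcap_n D n = set0.
    rewrite -subset0 => x Dx; have [[k _ Fkx] _] := Dx 0%N I.
    have [_] := Dx k.+1 I; apply.
    by rewrite /G -bigcup_mkord; exists k => /=.
  rewrite -(measure0 m) -D0; apply: nonincreasing_cvg_mu => //.
  - by rewrite ltey_eq fin_num_measure.
  - by rewrite D0.
  - move=> n k nk; apply/subsetPset => x [Fx Gx]; split => // Gnx; apply: Gx.
    move: Gnx; rewrite /G -!bigcup_mkord => -[i /= ni Fix]; exists i => //=.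
    exact: leq_trans ni nk.
apply/cvgrPdist_lt => e e0; have [r r0 mr] := L_abs_continuous e0.
have /fine_cvgP[_ /cvgrPdist_lt /(_ _ r0)] := mD0; apply: filterS => n /=.
rewrite sub0r normrN ger0_norm ?fine_ge0// => Dr.
rewrite LD ger0_norm//; apply: mr => //.
by rewrite -(fineK (fin_num_measure m _ (mD n))) lte_fin.
Qed.

HB.instance Definition _ := isMeasure.Build _ _ _ additive_measure
  additive_measure0 additive_measure_ge0 additive_measure_sigma_additive.

Let additive_measure_fin : fin_num_fun additive_measure.
Proof. by []. Qed.

HB.instance Definition _ :=
  Measure_isFinite.Build _ _ _ additive_measure additive_measure_fin.

Lemma additive_measureP : exists n : {finite_measure set T -> \bar R},
  forall A, n A = (L A)%:E.
Proof. by exists additive_measure. Qed.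

End setwise_limit.

(** Compactness of the segment gives a cluster point; an ultrafilter contains each set or its
    complement, so its image converges there. *)
Lemma ultrafilter_bounded_cvg {R : realType} T (F : set_system T)
    (f : T -> R) a b :
  UltraFilter F -> F [set x | a <= f x <= b] ->
  exists2 l, a <= l <= b & f @ F --> l.
Proof.
move=> FU Fab; have := @segment_compact R a b (f @ F) _ Fab.
move=> [l [/= lab cl]]; exists l; first by move: lab; rewrite in_itv.
move=> B lB; have [//|FnB] := in_ultra_setVsetC (f @^-1` B) FU.
by have [x [nBx Bx]] := cl (~` B) B FnB lB.
Qed.

(** * Weak coercivity *)

Section coercivity.
Context {R : realType} {X : ptopologicalType}.
Variables (m : Mb R X) (t : R).

(** The entropy bound at [c = 1] on the whole space, then monotonicity. *)
Lemma KL_mass_le (nu : Mb R X) : (KL m nu <= t%:E)%E ->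
  forall A : set (borel X), measurable A ->
  0 <= fine (nu A) <= t + (expR 1 - 1) * fine (m setT).
Proof.
move=> nut A mA; rewrite fine_ge0//=.
apply: (@le_trans _ _ (fine (nu setT))).
  by rewrite fine_le ?fin_num_measure// le_measure ?inE.
have := le_trans (KL_indic m nu 1 (@measurableT _ (borel X))) nut.
by rewrite lee_fin mul1r lerBlDr.
Qed.

(* Along an ultrafilter the sublevel measures converge on every Borel set.
   The entropy bound [c * nu A <= t + (expR c - 1) * m A] is inherited by the
   limit and makes it countably additive. *)
Lemma KL_setwise_limit (F : set_system (Mb R X)) : UltraFilter F ->
  F [set nu | (KL m nu <= t%:E)%E] ->
  exists n : Mb R X, forall A : set (borel X), measurable A ->
    (fun nu : Mb R X => fine (nu A)) @ F --> fine (n A).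
Proof.
move=> FU Ft.
have lim A : exists l : R, 0 <= l /\ (measurable A ->
    (fun nu : Mb R X => fine (nu A)) @ F --> l).
  (* The limit must be nonnegative on all sets, so non-measurable ones get the default value 0. *)
  have [mA|nmA] := pselect (measurable A); last by exists 0.
  have [|l /andP[l0 _] Fl] := @ultrafilter_bounded_cvg R _ F
    (fun nu => fine (nu A)) 0 (t + (expR 1 - 1) * fine (m setT)).
    by apply: filterS Ft => nu /= nut; exact: KL_mass_le.
  by exists l.
have [L LP] := choice lim.
have L_cvg A : measurable A -> (fun nu : Mb R X => fine (nu A)) @ F --> L A.
  by move=> mA; exact: (LP A).2.
have [n nL] : exists n : Mb R X, forall A, n A = (L A)%:E.
  apply: (@additive_measureP _ (borel X) R m L).
  - apply: (@cvg_unique _ _ ((fun nu : Mb R X => fine (nu set0)) @ F)) => //.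
      exact: L_cvg.
    rewrite (_ : (fun nu : Mb R X => _) = cst 0); first exact: cvg_cst.
    by apply/funext => nu; rewrite (measure0 nu).
  - by move=> A; exact: (LP A).1.
  - move=> A B mA mB AB0.
    apply: (@cvg_unique _ _ ((fun nu : Mb R X => fine (nu (A `|` B))) @ F)) => //.
      by apply: L_cvg; exact: measurableU.
    rewrite (_ : (fun nu : Mb R X => _) = fun nu => fine (nu A) + fine (nu B)).
      by apply: cvgD; exact: L_cvg.
    apply/funext => nu; rewrite -fineD ?fin_num_measure//; congr fine.
    exact: (measureU nu).
  (* If [m A < 1 / (expR c - 1)], the bound passed to the limit gives [c * L A < t + 1], which is
     below [c * e = 2 * (|t| + 1)]. *)
  - move=> e e0; pose c := (2 * (`|t| + 1)) / e.
    have c0 : 0 < c by rewrite divr_gt0// mulr_gt0// ltr_wpDl.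
    have k0 : 0 < expR c - 1 by rewrite subr_gt0 expR_gt1.
    exists ((expR c - 1)^-1); first by rewrite invr_gt0.
    move=> A mA mAe.
    have cL : c * L A <= t + (expR c - 1) * fine (m A).
      apply: (@cvgr_to_le _ F _ R (fun nu : Mb R X => c * fine (nu A))).
      + by apply: cvgM; [exact: cvg_cst|exact: L_cvg].
      + apply: filterS Ft => nu /= nut.
        have := le_trans (KL_indic m nu c mA) nut.
        by rewrite lee_fin lerBlDr.
    have kA : (expR c - 1) * fine (m A) < 1.
      rewrite -ltr_pdivlMl// mulr1 -lte_fin fineK// fin_num_measure//.
    have cE : c * e = 2 * (`|t| + 1) by rewrite divfK// gt_eqF.
    have : c * L A < c * e.
      by rewrite cE; have := ler_norm t; have := normr_ge0 t; lra.
    by rewrite ltr_pM2l.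
by exists n => A mA; rewrite nL; exact: L_cvg.
Qed.

(** Convergence of integrals extends from indicators by [bounded_measurable_ind]; stability under
    uniform limits uses the uniform mass bound on the sublevel set. *)
Lemma setwise_weak_cvg (F : set_system (Mb R X)) (n : Mb R X) : ProperFilter F ->
  F [set nu | (KL m nu <= t%:E)%E] ->
  (forall A : set (borel X), measurable A ->
    (fun nu : Mb R X => fine (nu A)) @ F --> fine (n A)) ->
  F --> n.
Proof.
move=> FF Ft Fn; apply/weak_cvgP => f cf [M [_ fM]].
pose Q (g : borel X -> R) :=
  (fun nu : Mb R X => \int[nu]_(x in setT) g x) @ F --> \int[n]_(x in setT) g x.
have i nu g := @Mb_integrable R X nu g.
suff : Q f by [].
apply: (@bounded_measurable_ind _ (borel X) R Q); last first.
- split; first exact: continuous_measurable_borel.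
  (* [bounded_fun] provides the bound only for reals strictly above [M]. *)
  by exists (M + 1) => x; apply: fM => //; rewrite ltrDl.
- move=> g bg apx; apply/cvgrPdist_lt => e e0.
  pose B := t + (expR 1 - 1) * fine (m setT) + fine (n setT).
  have nB nu : (KL m nu <= t%:E)%E -> fine (nu setT) + fine (n setT) <= B.
    move=> nut; rewrite lerD2r.
    by have /andP[] := KL_mass_le nut (@measurableT _ (borel X)).
  have B0 : 0 <= B.
    have [nu /nB] := filter_ex Ft; apply: le_trans.
    by rewrite addr_ge0 ?fine_ge0.
  have B1 : 0 < B + 1 by rewrite ltr_wpDl.
  (* As [B] bounds the sum of the two masses, replacing [g] by [h] under both measures costs at most
     [e / 2]; the other half is for the convergence of the integrals of [h]. *)
  have e1 : 0 < e / 2 / (B + 1) by rewrite !divr_gt0.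
  have [h [bh Qh gh]] := apx _ e1.
  have e2 : 0 < e / 2 by rewrite divr_gt0.
  have /cvgrPdist_lt /(_ _ e2) := Qh; apply: filterS2 Ft => nu /= /nB nuB hnu.
  have g1 := Rintegral_dist_le (Mb_fin n) bg bh gh.
  have g2 := Rintegral_dist_le (Mb_fin nu) bg bh gh.
  have eB : e / 2 / (B + 1) * (fine (nu setT) + fine (n setT)) <= e / 2.
    rewrite mulrAC ler_pdivrMr// ler_pM2l//; lra.
  move: g1 g2 hnu eB; rewrite mulrDr.
  move: (\int[n]_(x in setT) g x) (\int[nu]_(x in setT) g x)
    (\int[n]_(x in setT) h x) (\int[nu]_(x in setT) h x) => p q u v.
  rewrite !ler_norml !ltr_norml => /andP[? ?] /andP[? ?] /andP[? ?] ?.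
  by apply/andP; split; lra.
- move=> r g bg Qg; rewrite /Q RintegralZl//; last exact: i.
  rewrite (_ : (fun nu : Mb R X => _) = fun nu => r * \int[nu]_(x in setT) g x).
    by apply: cvgM; [exact: cvg_cst|exact: Qg].
  by apply/funext => nu; rewrite RintegralZl//; exact: i.
- move=> g h bg bh Qg Qh; rewrite /Q RintegralD//; [|exact: i..].
  rewrite (_ : (fun nu : Mb R X => _) = fun nu =>
    \int[nu]_(x in setT) g x + \int[nu]_(x in setT) h x).
    by apply: cvgD; [exact: Qg|exact: Qh].
  by apply/funext => nu; rewrite RintegralD//; exact: i.
- move=> A mA; rewrite /Q Rintegral_indic//.
  under eq_fun => nu do rewrite Rintegral_indic//.
  exact: Fn.
Qed.

End coercivity.

(** Semicontinuity makes sublevel sets closed, so precompactness becomes compactness and is tested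
    on ultrafilters, whose setwise limits are weak limits. *)
Lemma weakly_coercive_KL {R : realType} {X : ptopologicalType} (m : Mb R X) :
  lower_semicontinuous (KL m) -> weakly_coercive (KL m).
Proof.
move=> lsc t; have clt : closed [set nu | (KL m nu <= t%:E)%E].
  rewrite -openC (_ : ~` _ = [set nu | (t%:E < KL m nu)%E]).
    by have /lower_semicontinuousP := lsc; exact.
  by apply/seteqP; split => nu /=; rewrite ltNge => /negP.
rewrite precompact_closed// compact_ultra => F FU Ft.
have [n Fn] := KL_setwise_limit FU Ft.
have Fcn : F --> n by exact: setwise_weak_cvg Ft Fn.
exists n; split => //.
exact: (@closed_cvg _ _ F _ id _ clt Ft n Fcn).
Qed.

(* [contract] is the increasing homeomorphism of [\bar R] onto [[-1, 1]]; it is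
   needed because the distance to [~` U] is infinite when [U] is everything. *)
Lemma open_cozero_pseudometric {R : realType} {X : pseudoMetricType R} (U : set X) :
  open U -> exists2 g : X -> R, continuous g & U = [set x | 0 < g x].
Proof.
move=> oU; pose d (x : X) := edist_inf (~` U) x.
exists (fun x => contract (d x)) => [x|].
  apply/cvgrPdist_lt => e e0.
  have /cvg_ballP /(_ _ e0) := @edist_inf_continuous R X (~` U) x.
  by apply: filterS => y; rewrite /ball/= /ereal_ball.
have dE x : (0 < contract (d x)) = (0 < d x)%E.
  by rewrite -[0](@contract0 R) lt_contract.
apply/seteqP; split => x /=; rewrite dE.
  move=> Ux; have /nbhs_ballP[e /= e0 eU] : nbhs x U by exact: open_nbhs_nbhs.
  rewrite (@lt_le_trans _ _ e%:E)// le_ereal_inf_tmp// => _ [y nUy <-].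
  by rewrite leNgt; apply/negP => /edist_lt_ball /eU.
move=> dx; apply: contrapT => nUx; move: dx.
by rewrite /d edist_inf0// ltxx.
Qed.

Theorem proposition4p11 (R : realType) (N : nat) (hN : (0 < N)%N)
    (ip : {dot phase R N for idfun})
    (mu : {measure set (borel (phase R N * phase R N)%type) -> \bar R})
    (hmu : radon mu) (beta : R) (hbeta : 0 < beta)
    (hfin : (thermalized ip mu beta setT < +oo)%E) :
  let mu_beta := thermalized_Mb hfin in
  [/\ lower_semicontinuous (KL mu_beta),
      weakly_coercive (KL mu_beta) &
      unique_minimizer (KL mu_beta) mu_beta].
Proof.
move=> mu_beta.
have lsc : lower_semicontinuous (KL mu_beta).
  (* The topology of the product of phase spaces is pseudometric, so its open sets are cozero
     sets. *)
  by apply: lower_semicontinuous_KL => U oU; exact: open_cozero_pseudometric.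
split => //; first exact: weakly_coercive_KL.
exact: unique_minimizer_KL.
Qed.
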